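(* Let $d$ be an odd prime, let $\kappa\in\mathbb{Z}_d^\times$ satisfy $\gcd(\kappa^2-1,d)=1$, and suppose that either $\kappa$ generates $\mathbb{Z}_d^\times$, or $d\equiv 3\bmod 4$ and $\kappa$ has order $(d-1)/2$ in $\mathbb{Z}_d^\times$. Let $a,b,c\in\mathbb{Z}_d$ and let $g\in\mathbb{C}^d$ be a unit vector satisfying $$g_{\kappa i}=\omega^{a\binom i2+bi+c}\,g_i\qquad\text{for all } i\in\mathbb{Z}_d .$$ Let $m$ be the number of distinct values among $|\langle g,M^kT^\ell g\rangle|$, $(k,\ell)\in\mathbb{Z}_d\times\mathbb{Z}_d$. Then $$m\le d+2\qquad\text{and}\qquad \mathrm{rank}(G(g))\equiv d^2 \pmod{d-1}.$$
   Context: Vectors in $\mathbb{C}^d$ are indexed by $\mathbb{Z}_d=\mathbb{Z}/d\mathbb{Z}$, $\omega=e^{2\pi i/d}$, $\langle x,y\rangle=\sum_nx_n\overline{y_n}$; since $d$ is odd, $\binom i2=i(i-1)/2$ is well defined in $\mathbb{Z}_d$. The modulation and translation operators are $(Mg)_n=\omega^ng_n$ and $(Tg)_n=g_{n-1}$. With $\Pi_{k,\ell}=(M^kT^\ell g)(M^kT^\ell g)^*$, $G(g)$ is the $d^2\times d^2$ Gram matrix $(\mathrm{tr}(\Pi_{k,\ell}\Pi_{k',\ell'}^* ))_{(k,\ell),(k',\ell')}$. *)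

(* Defs.v *)
From HB Require Import structures.
From mathcomp Require Import all_boot all_order all_algebra all_fingroup.
From mathcomp Require Import spectral.
From mathcomp Require Import reals trigo.
From mathcomp Require Import complex.

Set Implicit Arguments.
Unset Strict Implicit.
Unset Printing Implicit Defensive.

Import GRing.Theory Num.Theory.
Local Open Scope ring_scope.
Local Open Scope complex_scope.
Local Open Scope sesquilinear_scope.

(* 'Z_d is definitionally 'I_(Zp_trunc d).+2, so a column vector of this size
   has its entries indexed by 'Z_d; its dimension is d as soon as 1 < d. *)
Notation "''Vec[' R ]_ d" := 'cV[R[i]]_(Zp_trunc d).+2
  (at level 8, R at level 50, d at level 2, format "''Vec[' R ]_ d") : type_scope.

Section WeylHeisenberg.
Variables (R : realType) (d : nat).
Implicit Types (g x y : 'Vec[R]_d) (k l n : 'Z_d).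

(* exp (2 i pi / d) *)
Definition omega : R[i] :=
  cos (2 * pi / d%:R : R) +i* sin (2 * pi / d%:R : R).

(* omega ^ n for n in Z/dZ, through the representative of n in {0, .., d-1} *)
Definition omega_pow n : R[i] := omega ^+ (n : nat).

Definition inner x y : R[i] := \sum_n x n 0 * (y n 0)^*.

Definition modulation g : 'Vec[R]_d := \col_n (omega_pow n * g n 0).

Definition translation g : 'Vec[R]_d := \col_(n < _) g ((n : 'Z_d) - 1) 0.

(* M^k T^l g *)
Definition weyl_heisenberg k l g : 'Vec[R]_d :=
  iter k modulation (iter l translation g).

Definition projection g k l : 'M[R[i]]_((Zp_trunc d).+2) :=
  weyl_heisenberg k l g *m (weyl_heisenberg k l g)^t*.

(* The rows and columns are indexed by Z/dZ x Z/dZ, through its enumeration. *)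
Definition gram g : 'M[R[i]]_#|{: 'Z_d * 'Z_d}| :=
  \matrix_(p, q)
    \tr (projection g (enum_val p).1 (enum_val p).2
         *m (projection g (enum_val q).1 (enum_val q).2)^t*).

Definition num_angles g : nat :=
  size (undup [seq (`|inner g (weyl_heisenberg kl.1 kl.2 g)| : R[i])
              | kl : 'Z_d * 'Z_d]).

(* i (i - 1) / 2, computed in Z/dZ, where 2 is invertible for odd d *)
Definition binom2 (j : 'Z_d) : 'Z_d := j * (j - 1) / 2%:R.

End WeylHeisenberg.
Arguments omega_pow R {d} n.

(* Main.v *)
Require Import Defs.
From HB Require Import structures.
From mathcomp Require Import all_boot all_order all_algebra all_fingroup.
From mathcomp Require Import cyclic spectral ring zify.
From mathcomp Require Import reals trigo complex.

(** Let A(k, l) be the ambiguity function of g, the sum over n of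
    g_n conj (omega^(k n) g_(n-l)); it is the inner product of g with M^k T^l g.

    Symmetry.  Substituting kappa * n for n in A, and using the functional
    equation of g, shows that |A| is invariant under
    (k, l) |-> (kappa k - a l / kappa, l / kappa) ([ambiguity_dilation]).  This
    linear map is triangular with eigenvalues kappa and 1 / kappa, which differ
    because kappa^2 - 1 is a unit; the shear k = u + s l with
    s = a / (kappa^2 - 1) makes it diagonal.  So F(u, l) = |A(u + s l, l)| is
    invariant under (u, l) |-> (kappa u, l / kappa), and it is also even
    ([ambiguity_opp]).  The units t such that F is invariant under
    (u, l) |-> (t u, l / t) form a group, which contains kappa and -1 and
    hence, by the assumption on the order of kappa, every unit
    ([hyperbolic_stab_full]).

    Angles.  The units have d + 2 orbits for this action: those of the d points
    (1, x), which are the hyperbolas u l = x and, for x = 0, the axis l = 0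
    without the origin; the axis u = 0 without the origin; and the origin.  So F takes at most d + 2 values ([size_hyperbolic_values]).

    Rank.  The Gram matrix is the convolution matrix of |A|^2 on (Z/dZ)^2,
    diagonalised by characters, and |A|^2 is up to the factor d its own
    symplectic Fourier transform ([ambiguity_duality]).  Hence the rank is the
    number of points where A does not vanish ([rank_gram]).  That set is a union
    of orbits; it contains the origin, since g is a unit vector, and every other
    orbit has d - 1 points, so the rank is 1 modulo d - 1, like d^2
    ([hyperbolic_count]). *)

Import Order.TTheory GRing.Theory Num.Theory.
Local Open Scope ring_scope.

(** * Prime moduli and diagonal matrices *)

Lemma Zp_prime_unitE d (x : 'Z_d) :
  prime d -> (x \is a GRing.unit) = (x != 0).
Proof.
move=> d_pr; have d1 := prime_gt1 d_pr.
rewrite -[x in LHS]natr_Zp unitZpE // prime_coprime // -val_eqE /=.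
rewrite -lt0n; case: (posnP x) => [-> |x0]; first by rewrite dvdn0.
by rewrite gtnNdvd // -{2}(Zp_cast d1) ltn_ord.
Qed.

Lemma card_Zp_prime d : prime d -> #|'Z_d| = d.
Proof. by move=> /prime_gt1 d1; rewrite card_ord Zp_cast. Qed.

Lemma Zp_unit2 d : prime d -> odd d -> (2%:R : 'Z_d) \is a GRing.unit.
Proof. by move=> /prime_gt1 d1 d_odd; rewrite unitZpE // coprimen2. Qed.

Lemma rank_diag_mx (K : fieldType) n (v : 'rV[K]_n) :
  \rank (diag_mx v) = (\sum_(i < n) (v 0%R i != 0%R))%N.
Proof.
elim: n v => [|n IHn] v; first by rewrite [diag_mx v]flatmx0 mxrank0 big_ord0.
rewrite -[n.+1]/(1 + n)%N in v *.
rewrite -[v in LHS]hsubmxK diag_mx_row rank_diag_block_mx IHn big_split_ord /=.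
congr (_ + _)%N.
  rewrite big_ord1 (_ : diag_mx _ = lsubmx v).
    rewrite rank_rV; congr (nat_of_bool (~~ _)); apply/eqP/eqP => [/rowP/(_ 0)|v0].
      by rewrite !mxE.
    by apply/rowP => i; rewrite !ord1 !mxE.
  by apply/matrixP => i j; rewrite !ord1 !mxE eqxx.
by apply: eq_bigr => i _; rewrite !mxE.
Qed.

(** * The character omega ^ n *)

Section OmegaCharacter.
Variables (R : realType) (d : nat).
Hypothesis d_gt2 : (2 < d)%N.

Let d_gt1 : (1 < d)%N := ltnW d_gt2.

Lemma omegaX n : omega R d ^+ n =
  (cos (2 * pi / d%:R *+ n : R) +i* sin (2 * pi / d%:R *+ n : R))%C.
Proof.
rewrite /omega; set t := _ / _.
elim: n => [|n IHn]; first by rewrite expr0 !mulr0n cos0 sin0.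
rewrite exprS IHn mulrS cosD sinD.
by apply/eqP; rewrite eq_complex /= eqxx /= addrC.
Qed.

Lemma omega_expd : omega R d ^+ d = 1.
Proof.
rewrite omegaX -mulr_natr divfK; last by rewrite pnatr_eq0 -lt0n ltnW.
by rewrite mulrC mulr_natr cos2pi sin2pi.
Qed.

(** The angle 2 pi / d lies strictly between 0 and pi, as d > 2, so its sine is
    positive. *)
Lemma omega_neq1 : omega R d != 1.
Proof.
rewrite /omega eq_complex /= negb_and; apply/orP; right.
have d0 : 0 < d%:R :> R by rewrite ltr0n ltnW.
rewrite gt_eqF // sin_gt0_pi // divr_gt0 ?mulr_gt0 ?pi_gt0 //=.
by rewrite ltr_pdivrMr // mulrC ltr_pM2l ?pi_gt0 // ltr_nat.
Qed.

(** The exponents of [omega_pow] are representatives in [0, d), so additivity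
    on Z/dZ is where omega ^ d = 1 enters. *)
Lemma omega_powD (x y : 'Z_d) : omega_pow R (x + y) = omega_pow R x * omega_pow R y.
Proof.
rewrite /omega_pow -exprD [LHS]/= expr_mod // Zp_cast //; exact: omega_expd.
Qed.

Lemma omega_pow1 : omega_pow R (1 : 'Z_d) != 1.
Proof. by rewrite /omega_pow /= Zp_cast // modn_small // expr1 omega_neq1. Qed.

(** A root of unity has modulus 1, so that its conjugate is its inverse. *)
Lemma conj_omega_pow (x : 'Z_d) : (omega_pow R x)^* = omega_pow R (- x).
Proof.
have w1 : `|omega R d| = 1.
  apply/eqP; rewrite -(@pexpr_eq1 _ _ d) ?normr_ge0 1?ltnW //.
  by rewrite -normrX omega_expd normr1.
have e1 : `|omega_pow R x| = 1 by rewrite normrX w1 expr1n.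
have e0 : omega_pow R x != 0 by rewrite -normr_eq0 e1 oner_eq0.
apply: (mulfI e0); rewrite -normCK e1 -omega_powD subrr expr1n.
by rewrite /omega_pow expr0.
Qed.

End OmegaCharacter.

(** * The ambiguity function *)

Section Ambiguity.
Variables (C : numClosedFieldType) (d : nat) (e : 'Z_d -> C).
Hypothesis d_prime : prime d.
Hypothesis e0 : e 0 = 1.
Hypothesis eD : forall x y, e (x + y) = e x * e y.
Hypothesis e1 : e 1 != 1.
Hypothesis conj_e : forall x, (e x)^* = e (- x).
Implicit Types (f : 'Z_d -> C) (k l x y : 'Z_d).

Lemma norm_char x : `|e x| = 1.
Proof.
by apply/eqP; rewrite -sqrp_eq1 // normCK conj_e -eD subrr e0.
Qed.

(** Orthogonality of characters.  For x <> 0 the map k |-> k * x permutes Z/dZ,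
    because d is prime, and the full sum of e is unchanged when it is multiplied
    by e 1 <> 1. *)
Lemma sum_char x : \sum_k e (k * x) = if x == 0 then d%:R else 0.
Proof.
case: eqVneq => [-> |x0].
  rewrite (eq_bigr (fun=> 1)) => [|k _]; last by rewrite mulr0 e0.
  by rewrite sumr_const card_Zp_prime.
have ux : x \is a GRing.unit by rewrite Zp_prime_unitE.
rewrite (reindex_inj (mulIr (etrans (unitrV x) ux))) /=.
under eq_bigr do rewrite mulrVK //.
apply/eqP; have := subrr (\sum_k e k).
rewrite {1}(reindex_inj (addrI 1)) /=.
under eq_bigr do rewrite eD.
rewrite -mulr_sumr -[X in _ - X]mul1r -mulrBl => /eqP.
by rewrite mulf_eq0 subr_eq0 (negbTE e1).
Qed.

(** The minus sign is that of the symplectic pairing of (x, y) with (k, l), which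
    [ambiguity_duality] needs. *)
Lemma sum_char2 x y :
  \sum_(r : 'Z_d * 'Z_d) e (r.1 * x - r.2 * y) =
  if (x == 0) && (y == 0) then d%:R ^+ 2 else 0.
Proof.
transitivity ((\sum_k e (k * x)) * (\sum_l e (l * - y))).
  rewrite big_distrlr pair_big /=; apply: eq_bigr => r _.
  by rewrite -eD mulrN.
rewrite !sum_char oppr_eq0.
by case: eqP => _; case: eqP => _; rewrite ?mulr0 ?mul0r.
Qed.

Definition ambiguity f k l : C := \sum_n f n * (e (k * n) * f (n - l))^*.

(** The substitution n |-> n - l turns the left-hand side into the conjugate of
    the ambiguity function at (k, l), up to the phase e (- k l). *)
Lemma ambiguity_opp f k l : `|ambiguity f (- k) (- l)| = `|ambiguity f k l|.
Proof.
have -> : ambiguity f (- k) (- l) = e (- (k * l)) * (ambiguity f k l)^*.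
  rewrite /ambiguity rmorph_sum mulr_sumr (reindex_inj (addIr (- l))) /=.
  apply: eq_bigr => n _; rewrite opprK subrK !rmorphM /= !conjCK !conj_e.
  have -> : - (- k * (n - l)) = - (k * l) + k * n by ring.
  by rewrite eD; ring.
by rewrite normrM norm_char mul1r norm_conjC.
Qed.

(** The substitution n |-> t * n.  The phase of f is quadratic in n, so the
    difference of its values at n and n - m is affine in n: its slope a * m
    shifts the frequency, and its constant term is a global phase, which the
    modulus forgets.  Here h stands for 1 / 2. *)
Lemma ambiguity_dilation f (t a b c h : 'Z_d) :
  t \is a GRing.unit -> h * 2%:R = 1 ->
  (forall n, f (t * n) = e (a * (n * (n - 1) * h) + b * n + c) * f n) ->
  forall k l, `|ambiguity f (t * k - a * (t^-1 * l)) (t^-1 * l)| = `|ambiguity f k l|.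
Proof.
move=> ut h2 ft k l; set m := t^-1 * l.
have lE : l = t * m by rewrite /m mulVKr.
suff -> : ambiguity f k l =
    e (- (a * (m ^+ 2 + m) * h) + b * m) * ambiguity f (t * k - a * m) m.
  by rewrite normrM norm_char mul1r.
rewrite /ambiguity mulr_sumr (reindex_inj (mulrI ut)); apply: eq_bigr => n _.
have -> : t * n - l = t * (n - m) by rewrite lE mulrBr.
rewrite !ft !rmorphM /= !conj_e.
set u := f n; set v := (f _)^*.
transitivity (e (a * (n * (n - 1) * h) + b * n + c) * e (- (k * (t * n))) *
  e (- (a * ((n - m) * (n - m - 1) * h) + b * (n - m) + c)) * (u * v)); first by ring.
transitivity (e (- (a * (m ^+ 2 + m) * h) + b * m) * e (- ((t * k - a * m) * n)) * (u * v)); last by ring.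
rewrite -!eD; congr (e _ * _).
(* The two binomials leave the cross term 2 * h * a * m * n, so the same factor
   2 * h has to appear in the frequency shift. *)
have -> : a * m = a * m * (h * 2%:R) by rewrite h2 mulr1.
ring.
Qed.

(** The squared modulus of the ambiguity function is, up to the factor d, its own
    symplectic Fourier transform.  Expanding the square gives a sum over k, l and
    two positions n, m; the sum over k forces n = m + x, and what is left is the
    expansion of the right-hand side, after the change of variable l = m - j. *)
Lemma ambiguity_duality f x y :
  \sum_(r : 'Z_d * 'Z_d) `|ambiguity f r.1 r.2| ^+ 2 * e (r.1 * x - r.2 * y) =
  d%:R * `|ambiguity f y x| ^+ 2.
Proof.
pose c l n := f n * (f (n - l))^*.
have ambE k l : `|ambiguity f k l| ^+ 2 =
    \sum_n \sum_m c l n * (c l m)^* * e (k * (m - n)).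
  rewrite normCK /ambiguity rmorph_sum mulr_suml; apply: eq_bigr => n _.
  rewrite mulr_sumr; apply: eq_bigr => m _.
  rewrite /c !rmorphM /= !conjCK conj_e.
  have -> : k * (m - n) = - (k * n) + k * m by ring.
  by rewrite eD; ring.
have sum_over_k l : \sum_k `|ambiguity f k l| ^+ 2 * e (k * x - l * y) =
    d%:R * \sum_m c l (m + x) * (c l m)^* * e (- (l * y)).
  transitivity (\sum_m \sum_n c l n * (c l m)^* * e (- (l * y)) *
                  \sum_k e (k * (m - n + x))).
    under eq_bigr do rewrite ambE mulr_suml.
    rewrite exchange_big [RHS]exchange_big /=; apply: eq_bigr => n _.
    under eq_bigr do rewrite mulr_suml.
    rewrite exchange_big /=; apply: eq_bigr => m _.
    rewrite mulr_sumr; apply: eq_bigr => k _.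
    have -> : k * (m - n + x) = k * (m - n) + k * x by ring.
    by rewrite !eD; ring.
  rewrite mulr_sumr; apply: eq_bigr => m _.
  rewrite (bigD1 (m + x)) //= [X in _ + X]big1 ?addr0 => [|n n_m].
    have -> : m - (m + x) + x = 0 by ring.
    by rewrite sum_char eqxx mulrC.
  have -> : m - n + x = m + x - n by ring.
  by rewrite sum_char subr_eq0 eq_sym (negbTE n_m) mulr0.
transitivity (\sum_l \sum_k `|ambiguity f k l| ^+ 2 * e (k * x - l * y)).
  by rewrite exchange_big pair_big.
under eq_bigr do rewrite sum_over_k.
rewrite -mulr_sumr; congr (_ * _); rewrite exchange_big ambE /=.
rewrite [RHS](reindex_inj (addIr x)) /=; apply: eq_bigr => m _.
rewrite [RHS](reindex_inj (addIr x)) [LHS](reindex_inj (can_inj (subKr m))) /=.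
apply: eq_bigr => j _; rewrite /c !addrK subKr !rmorphM /= !conjCK.
have -> : m + x - (m - j) = j + x by ring.
have -> : - ((m - j) * y) = y * (j + x - (m + x)) by ring.
ring.
Qed.

End Ambiguity.

(** * Functions constant on hyperbolas *)

Section HyperbolicInvariance.
Variables (T : eqType) (d : nat) (F : 'Z_d -> 'Z_d -> T).
Hypothesis d_prime : prime d.
Implicit Types (k l u x : 'Z_d).

(** Encoded as a finite set, so that it is a group subject to Lagrange's theorem. *)
Definition hyperbolic_stab : {set {unit 'Z_d}} :=
  [set t | [forall p : 'Z_d * 'Z_d,
    F (FinRing.uval t * p.1) (FinRing.uval t^-1%g * p.2) == F p.1 p.2]].

Lemma hyperbolic_stabP (t : {unit 'Z_d}) :
  reflect (forall k l, F (FinRing.uval t * k) (FinRing.uval t^-1%g * l) = F k l)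
          (t \in hyperbolic_stab).
Proof.
rewrite inE; apply: (iffP forallP) => [Ft k l|Ft p]; last exact/eqP/Ft.
exact/eqP/(Ft (k, l)).
Qed.

Lemma hyperbolic_stab_group_set : group_set hyperbolic_stab.
Proof.
apply/group_setP; split.
  by apply/hyperbolic_stabP => k l; rewrite invg1 !FinRing.val_unit1 !mul1r.
move=> s t /hyperbolic_stabP Fs /hyperbolic_stabP Ft.
apply/hyperbolic_stabP => k l.
rewrite -[RHS](Ft k l) -[RHS]Fs invMg !FinRing.val_unitM.
by rewrite -!mulrA; congr (F _ _); rewrite mulrCA.
Qed.
Canonical hyperbolic_stab_group := Group hyperbolic_stab_group_set.

(** A generator t of the unit group lies in no proper subgroup.  In the other
    case the stabiliser contains t, of odd order (d - 1) / 2, and, F being even, -1,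
    of order 2, so its order is divisible by d - 1, which is the number of units. *)
Lemma hyperbolic_stab_full (t : {unit 'Z_d}) :
  odd d ->
  (forall k l, F (- k) (- l) = F k l) ->
  t \in hyperbolic_stab ->
  <[t]>%g = [set: {unit 'Z_d}] \/ (d = 3 %[mod 4] /\ #[t]%g = ((d - 1) %/ 2)%N) ->
  hyperbolic_stab = [set: {unit 'Z_d}].
Proof.
move=> d_odd FN tH [tT|[d3 ot]].
  by apply/eqP; rewrite eqEsubset subsetT -tT cycle_subG.
have d1 := prime_gt1 d_prime.
have card_units : #|[set: {unit 'Z_d}]| = (d - 1)%N.
  by rewrite card_units_Zp ?totient_prime ?subn1 // ltnW.
have uN1 : (-1 : 'Z_d) \is a GRing.unit by rewrite unitrN1.
pose m1 := FinRing.Unit uN1 : {unit 'Z_d}.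
have m1H : m1 \in hyperbolic_stab.
  apply/hyperbolic_stabP => k l.
  by rewrite FinRing.val_unitV /= invrN1 !mulN1r FN.
have om1 : #[m1]%g = 2%N.
  apply/prime_nt_dvdP; rewrite ?order_eq1 ?order_dvdn //.
    apply: (contraTneq _ (Zp_unit2 _ d_prime d_odd)) => /(congr1 val) /= m11.
    by rewrite Zp_prime_unitE // negbK mulr2n -{1}m11 addNr.
  by apply/eqP/val_inj; rewrite FinRing.val_unitX /= sqrrN expr1n.
have tdvd : (#[t]%g %| #|hyperbolic_stab|)%N by rewrite order_dvdG.
have m1dvd : (#[m1]%g %| #|hyperbolic_stab|)%N by rewrite order_dvdG.
have: (#[m1]%g * #[t]%g %| #|hyperbolic_stab|)%N.
  rewrite Gauss_dvd ?m1dvd // om1 ot coprime2n.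
  by clear -d3; lia.
rewrite om1 ot => dvd; apply/eqP; rewrite eqEcard subsetT card_units /=.
apply: leq_trans (dvdn_leq (cardG_gt0 hyperbolic_stab_group) dvd).
by clear -d_odd; lia.
Qed.

Hypothesis F_hyp : hyperbolic_stab = [set: {unit 'Z_d}].

Lemma hyperbolic_scale t k l : t != 0 -> F (t * k) (t^-1 * l) = F k l.
Proof.
rewrite -Zp_prime_unitE // => ut.
have: FinRing.Unit ut \in hyperbolic_stab by rewrite F_hyp inE.
by move=> /hyperbolic_stabP/(_ k l).
Qed.

(** Off the axis k = 0, the product k * l is a complete invariant of the orbits,
    and the dilation by 1 / k reaches the representative (1, k * l). *)
Lemma hyperbolic_orbit k l : k != 0 -> F k l = F 1 (k * l).
Proof.
move=> k0; have uk : k \is a GRing.unit by rewrite Zp_prime_unitE.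
have k0' : k^-1 != 0 by rewrite -Zp_prime_unitE // unitrV.
by rewrite -(hyperbolic_scale _ _ _ k0') invrK mulVr.
Qed.

Lemma hyperbolic_axis l : l != 0 -> F 0 l = F 0 1.
Proof.
move=> l0; rewrite -(hyperbolic_scale _ _ _ l0) mulr0 mulVr //.
by rewrite Zp_prime_unitE.
Qed.

(** The d orbits of the points (1, x), the punctured axis and the origin cover
    the plane. *)
Lemma size_hyperbolic_values (s : seq T) :
  {subset s <= [seq F p.1 p.2 | p : 'Z_d * 'Z_d]} ->
  (size (undup s) <= d + 2)%N.
Proof.
move=> sF.
have <- : size (F 0 0 :: F 0 1 :: [seq F 1 x | x : 'Z_d]) = (d + 2)%N.
  by rewrite /= size_image card_Zp_prime // addn2.
apply: uniq_leq_size (undup_uniq s) _ => y; rewrite mem_undup => /sF.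
case/imageP => -[k l] _ -> /=; rewrite !inE.
have [-> | k0] := eqVneq k 0.
  by have [-> | l0] := eqVneq l 0; rewrite ?(hyperbolic_axis _ l0) eqxx ?orbT.
by rewrite (hyperbolic_orbit _ l k0) image_f ?orbT.
Qed.

(** Every orbit other than the origin has d - 1 points. *)
Lemma hyperbolic_count (P : pred T) :
  P (F 0 0) ->
  (\sum_l \sum_k P (F k l) = d ^ 2 %[mod d - 1])%N.
Proof.
move=> P0; have d0 := prime_gt0 d_prime.
have cardN0 : #|[pred k : 'Z_d | k != 0]| = (d - 1)%N.
  by rewrite (cardC1 (0 : 'Z_d)) card_Zp_prime // subn1.
set N := (\sum_x P (F 1%R x))%N.
have -> : (\sum_l \sum_k P (F k l) = 1 + (d - 1) * P (F 0%R 1%R) + (d - 1) * N)%N.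
  rewrite exchange_big (bigD1 0) //= (bigD1 0) //= P0; congr (_ + _ + _)%N.
    rewrite (eq_bigr (fun=> (P (F 0 1) : nat))) => [|l l0]; last by rewrite hyperbolic_axis.
    by rewrite sum_nat_const cardN0.
  rewrite (eq_bigr (fun=> N)) => [|k k0]; first by rewrite sum_nat_const cardN0.
  have uk : k \is a GRing.unit by rewrite Zp_prime_unitE.
  rewrite /N [RHS](reindex_inj (mulrI uk)).
  by apply: eq_bigr => l _; rewrite hyperbolic_orbit.
(* d ^ 2 - 1 factors as (d - 1) (d + 1): both sides are 1 modulo d - 1. *)
have -> : (d ^ 2 = 1 + (d - 1) * (d + 1))%N by nia.
by rewrite -addnA -mulnDr ![(1 + _)%N]addnC ![((d - 1) * _)%N]mulnC !modnMDl.
Qed.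

End HyperbolicInvariance.

(** * The Gram matrix *)

Section Gram.
Variables (R : realType) (d : nat).
Hypothesis d_prime : prime d.
Hypothesis d_odd : odd d.
Implicit Types (k l : 'Z_d) (g x y : 'Vec[R]_d).
Local Open Scope complex_scope.
Local Open Scope sesquilinear_scope.

Let d_gt2 : (2 < d)%N.
Proof. by rewrite odd_prime_gt2. Qed.

Let e := @omega_pow R d.
Let e0 : e 0 = 1. Proof. by rewrite /e /omega_pow expr0. Qed.
Let eD k l : e (k + l) = e k * e l. Proof. exact: omega_powD. Qed.
Let e1 : e 1 != 1. Proof. exact: omega_pow1. Qed.
Let conj_e k : (e k)^*%R = e (- k). Proof. exact: conj_omega_pow. Qed.

Lemma weyl_heisenbergE g k l n :
  weyl_heisenberg k l g n 0 = e (k * n) * g (n - l) 0.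
Proof.
rewrite /weyl_heisenberg.
have trans m : iter m (@translation R d) g n 0 = g (n - m%:R) 0.
  elim: m n => [|m IHm] n; first by rewrite subr0.
  rewrite iterS mxE IHm; congr (g _ 0); ring.
have modul m x : iter m (@modulation R d) x n 0 = e (m%:R * n) * x n 0.
  elim: m => [|m IHm]; first by rewrite mul0r e0 mul1r.
  rewrite iterS mxE IHm mulrA; congr (_ * _).
  by rewrite -[omega_pow R n]/(e n) -eD -[in RHS]natr1; congr e; ring.
by rewrite modul trans !natr_Zp.
Qed.

(** Time-frequency shifts compose up to a phase, so these moduli depend only on
    the differences of the indices: the Gram matrix below is a convolution over
    the group of the index pairs. *)
Lemma inner_weyl_heisenberg g k l k' l' :
  `|inner (weyl_heisenberg k l g) (weyl_heisenberg k' l' g)| =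
  `|ambiguity _ _ e (fun n => g n 0) (k' - k) (l' - l)|.
Proof.
rewrite /inner /ambiguity (reindex_inj (addIr l)) /=.
have -> : \sum_n weyl_heisenberg k l g (n + l) 0 * (weyl_heisenberg k' l' g (n + l) 0)^*%R
  = e ((k - k') * l) * ambiguity _ _ e (fun n => g n 0) (k' - k) (l' - l).
  rewrite /ambiguity mulr_sumr; apply: eq_bigr => n _.
  rewrite !weyl_heisenbergE addrK !rmorphM /= !conj_e.
  have -> : n + l - l' = n - (l' - l) by ring.
  set u := g n 0; set v := (g _ _)^*%R.
  transitivity (e (k * (n + l)) * e (- (k' * (n + l))) * (u * v)); first by ring.
  transitivity (e ((k - k') * l) * e (- ((k' - k) * n)) * (u * v)); last by ring.
  by rewrite -!eD; congr (e _ * _); ring.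
by rewrite normrM (norm_char _ _ e e0 eD conj_e) mul1r.
Qed.

Lemma gramE g p q :
  gram g p q = `|ambiguity _ _ e (fun n => g n 0)
    ((enum_val q).1 - (enum_val p).1) ((enum_val q).2 - (enum_val p).2)| ^+ 2.
Proof.
rewrite mxE -inner_weyl_heisenberg /projection.
move: (weyl_heisenberg _ _ g) (weyl_heisenberg _ _ g) => x y.
have innerE (u v : 'Vec[R]_d) : (v^t* *m u) 0 0 = inner u v.
  by rewrite mxE; apply: eq_bigr => n _; rewrite !mxE mulrC.
have innerC (u v : 'Vec[R]_d) : inner v u = (inner u v)^*%R.
  rewrite /inner rmorph_sum; apply: eq_bigr => n _.
  by rewrite rmorphM /= conjCK mulrC.
rewrite trmx_mul map_mxM /= trmxCK -mulmxA mxtrace_mulC -!mulmxA mulmxA.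
rewrite trace_mx11 mxE big_ord1 !innerE normCK.
by rewrite -innerC mulrC.
Qed.

(** The characters of (Z/dZ)^2, normalised into the unitary matrix U, diagonalise
    the Gram matrix; by [ambiguity_duality] its eigenvalues are d times the
    squared moduli of the ambiguity function.  The rank counts those that do not
    vanish. *)
Lemma rank_gram g :
  \rank (gram g) =
  (\sum_l \sum_k (ambiguity _ _ e (fun n => g n 0%R) k l != 0%R))%N.
Proof.
set A := ambiguity _ _ e (fun n => g n 0).
have d0 : d%:R != 0 :> R[i] by rewrite pnatr_eq0 -lt0n prime_gt0.
pose ev : 'I_#|{: 'Z_d * 'Z_d}| -> 'Z_d * 'Z_d := enum_val.
have ev_bij : {on [pred r | true], bijective ev} by exact: onW_bij (enum_val_bij _).
(* The exponent is the symplectic form of the two index pairs. *)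
pose U := \matrix_(p < #|{: 'Z_d * 'Z_d}|, r < #|{: 'Z_d * 'Z_d}|)
  (d%:R^-1 * e ((enum_val r).2 * (enum_val p).1 - (enum_val r).1 * (enum_val p).2)).
pose v := \row_(r < #|{: 'Z_d * 'Z_d}|)
  (d%:R * `|A (enum_val r).1 (enum_val r).2| ^+ 2).
have U_unitary : U \is unitarymx.
  apply/unitarymxP/matrixP => p q; rewrite !mxE.
  transitivity (d%:R^-1 ^+ 2 * \sum_r e (r.1 * ((enum_val q).2 - (enum_val p).2) -
                                 r.2 * ((enum_val q).1 - (enum_val p).1))).
    rewrite mulr_sumr [RHS](reindex ev) //=.
    apply: eq_bigr => r _; rewrite !mxE rmorphM fmorphV rmorph_nat /= conj_e.
    rewrite mulrACA -expr2 -eD; congr (_ * e _); ring.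
  rewrite (sum_char2 _ _ _ d_prime e0 eD e1) !subr_eq0 andbC -xpair_eqE -!surjective_pairing.
  rewrite (inj_eq enum_val_inj) eq_sym; case: eqP => _; last by rewrite mulr0.
  by rewrite -exprMn mulVf ?expr1n.
have gramU : gram g = U *m diag_mx v *m U^t*.
  apply/matrixP => p q; rewrite gramE [RHS]mxE.
  apply: (mulfI d0); rewrite -(ambiguity_duality _ _ _ d_prime e0 eD e1 conj_e).
  rewrite mulr_sumr [LHS](reindex ev) //=.
  apply: eq_bigr => r _; rewrite mul_mx_diag !mxE rmorphM fmorphV rmorph_nat /= conj_e.
  set w := `|_| ^+ 2; set P := (X in d%:R^-1 * e X * _); set Q := (X in e (- X)).
  rewrite (_ : _ - _ = P + - Q); last by rewrite /P /Q; ring.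
  by rewrite eD; field.
rewrite gramU mxrankMfree ?row_free_unit ?unitarymx_unit ?trmxC_unitary //.
rewrite eqmxMfull ?row_full_unit ?unitarymx_unit // rank_diag_mx.
rewrite exchange_big pair_big /=.
rewrite [RHS](reindex ev) //=.
by apply: eq_bigr => r _; rewrite mxE mulf_eq0 (negbTE d0) expf_eq0 normr_eq0.
Qed.

End Gram.

(** * The number of angles and the rank *)

Theorem corollary1 (R : realType) (d : nat)
  (d_prime : prime d) (d_odd : odd d)
  (kappa : {unit 'Z_d})
  (kappa_gcd : gcdn ((FinRing.uval kappa ^+ 2 - 1 : 'Z_d)%R) d = 1%N)
  (kappa_order :
     (<[kappa]>%g = [set: {unit 'Z_d}]) \/
     (d = 3 %[mod 4] /\ #[kappa]%g = ((d - 1) %/ 2)%N))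
  (a b c : 'Z_d) (g : 'Vec[R]_d)
  (g_unit : inner g g = 1)
  (g_kappa : forall i : 'Z_d,
     g (FinRing.uval kappa * i) 0 = omega_pow R (a * binom2 i + b * i + c) * g i 0) :
  (num_angles g <= d + 2)%N /\ \rank (gram g) = (d ^ 2)%N %[mod d - 1].
Proof.
have d_gt2 : (2 < d)%N by rewrite odd_prime_gt2.
pose t := FinRing.uval kappa; pose e := @omega_pow R d.
have ut : t \is a GRing.unit := valP kappa.
have ut21 : t ^+ 2 - 1 \is a GRing.unit.
  rewrite Zp_prime_unitE //; apply/eqP => t21.
  by move: kappa_gcd d_gt2; rewrite -/t t21 gcd0n => ->.
have e0 : e 0 = 1 by rewrite /e /omega_pow expr0.
have eD k l : e (k + l) = e k * e l by exact: omega_powD.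
have conj_e k : ((e k)^*)%R = e (- k) by exact: conj_omega_pow.
pose A := ambiguity _ _ e (fun n => g n 0).
have inner_A k l : `|inner g (weyl_heisenberg k l g)| = `|A k l|.
  have := inner_weyl_heisenberg _ _ d_prime d_odd g 0 0 k l.
  by rewrite !subr0.
have A_t k l : `|A (t * k - a * (t^-1 * l)) (t^-1 * l)| = `|A k l|.
  apply: (ambiguity_dilation _ _ e e0 eD conj_e _ t a b c 2%:R^-1 ut _ g_kappa).
  by rewrite mulVr // Zp_unit2.
(* The slope s solves t ^+ 2 * s - a = s: the line k = s * l is an eigenline. *)
pose s := a / (t ^+ 2 - 1).
have a_s : a = s * (t ^+ 2 - 1) by rewrite divrK.
pose F k l := `|A (k + s * l) l|.
have F_shear k l : `|A k l| = F (k - s * l) l by rewrite /F subrK.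
have F_opp k l : F (- k) (- l) = F k l.
  by rewrite /F mulrN -opprD (ambiguity_opp _ _ e e0 eD conj_e).
have kappaF : kappa \in hyperbolic_stab _ _ F.
  apply/hyperbolic_stabP => k l; rewrite FinRing.val_unitV /= -/t /F -[RHS]A_t.
  set m := t^-1 * l; have -> : l = t * m by rewrite /m mulVKr.
  congr (`|A _ m|); rewrite [a]a_s; ring.
have F_full := hyperbolic_stab_full _ _ _ d_prime _ d_odd F_opp kappaF kappa_order.
split.
  apply: (size_hyperbolic_values _ _ F d_prime F_full) => y.
  case/imageP => -[k l] _ ->; apply/imageP; exists (k - s * l, l) => //=.
  by rewrite -F_shear inner_A.
rewrite rank_gram // -(hyperbolic_count _ _ F d_prime F_full (fun x => x != 0)).
  congr (_ %% _)%N; apply: eq_bigr => l _.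
  rewrite (reindex_inj (addIr (s * l))) /=; apply: eq_bigr => k _.
  by rewrite normr_eq0.
by rewrite /F mulr0 addr0 -inner_A g_unit normr1 oner_eq0.
Qed.
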